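(* Let $\mathbf{X}_1,\dots,\mathbf{X}_n,\mathbf{x}'\in\mathbb{R}^d$, $F_n=\frac1n\sum_{i=1}^n\delta_{\mathbf{X}_i}$ and $F_{n,s}=(1-s)F_n+s\delta_{\mathbf{x}'}$. Suppose the loss $\rho$ satisfies: (A1) $\rho$ is non-decreasing, $\rho(0)=0$, and $\rho(x)/x\to 0$ as $x\to 0$; (A2) $\varphi(0)\triangleq\lim_{x\to 0}\psi(x)/x$ exists and is finite; (A3) $\psi$ and $\varphi$ are continuous; (A4) $\psi$ and $\varphi$ are bounded; (A5) $\varphi$ is Lipschitz continuous. In addition, assume that - $f_{F_{n,s}}\to f_{F_n}$ as $s\to 0$ (this is satisfied when $J(g)=\frac1n\sum_{i=1}^n\rho(\|\Phi(\mathbf{X}_i)-g\|_{\mathcal{H}})$ is strictly convex on $\mathcal{H}$); - the extended kernel matrix $K'$ based on $\{\mathbf{X}_i\}_{i=1}^n\cup\{\mathbf{x}'\}$ (the matrix of values of $k_\sigma$ on pairs of these points) is positive definite. Then for all $\mathbf{x}\in\mathbb{R}^d$ $$IF(\mathbf{x},\mathbf{x}';\widehat{f}_{RKDE},F_n)=\sum_{i=1}^n\alpha_i k_\sigma(\mathbf{x},\mathbf{X}_i)+\alpha' k_\sigma(\mathbf{x},\mathbf{x}'),$$ where $$\alpha'=n\cdot\varphi(\|\Phi(\mathbf{x}')-f_{F_n}\|_{\mathcal{H}})/\gamma$$ and $\boldsymbol{\alpha}=[\alpha_1,\dots,\alpha_n]^T$ is the solution of the system of linear equations $$\bigl\{\gamma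 I_n+(I_n-\mathbf{1}\mathbf{w}^T)^TQ(I_n-\mathbf{1}\mathbf{w}^T)K\bigr\}\boldsymbol{\alpha}=-n\,\varphi(\|\Phi(\mathbf{x}')-f_{F_n}\|_{\mathcal{H}})\,\mathbf{w}-\alpha'(I_n-\mathbf{1}\mathbf{w}^T)^TQ(I_n-\mathbf{1}\mathbf{w}^T)\mathbf{k}'.$$
   Context: The kernel $k_\sigma:\mathbb{R}^d\times\mathbb{R}^d\to[0,\infty)$ satisfies $\int k_\sigma(\mathbf{x},\cdot)\,d\mathbf{x}=1$, is radial, meaning $k_\sigma(\mathbf{x},\mathbf{x}')=g_0(\|\mathbf{x}-\mathbf{x}'\|^2)$ for some function $g_0$, and is positive semi-definite. $\mathcal{H}$ is the reproducing kernel Hilbert space (real) associated with $k_\sigma$, and $\Phi(\mathbf{x})\triangleq k_\sigma(\cdot,\mathbf{x})\in\mathcal{H}$ is the canonical feature map, so $g(\mathbf{x})=\langle\Phi(\mathbf{x}),g\rangle_{\mathcal{H}}$ for $g\in\mathcal{H}$. The loss $\rho:[0,\infty)\to\mathbb{R}$ is differentiable, $\psi\triangleq\rho'$, $\varphi(x)\triangleq\psi(x)/x$ for $x>0$, and $q(x)=x\psi'(x)-\psi(x)$. $\delta_{\mathbf{y}}$ is the point mass at $\mathbf{y}$. For a probability distribution $\mu$ on $\mathbb{R}^d$, $f_\mu=\arg\min_{g\in\mathcal{H}}\int\rho(\|\Phi(\mathbf{x})-g\|_{\mathcal{H}})\,d\mu(\mathbf{x})$ and $\widehat{f}_{RKDE}(\mathbf{x};\mu)=f_\mu(\mathbf{x})=\langle\Phi(\mathbf{x}),f_\mu\rangle_{\mathcal{H}}$.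 For a function estimate $T(\mathbf{x};F)$ based on a distribution $F$ and evaluated at $\mathbf{x}$, the influence function is $$IF(\mathbf{x},\mathbf{x}';T,F)=\lim_{s\to 0}\frac{T(\mathbf{x};F_s)-T(\mathbf{x};F)}{s},\qquad F_s=(1-s)F+s\delta_{\mathbf{x}'},\ s\in[0,1).$$ Notation: $\mathbf{1}=[1,\dots,1]^T\in\mathbb{R}^n$; $\mathbf{k}'=[k_\sigma(\mathbf{x}',\mathbf{X}_1),\dots,k_\sigma(\mathbf{x}',\mathbf{X}_n)]^T$; $I_n$ is the $n\times n$ identity matrix; $K=(k_\sigma(\mathbf{X}_i,\mathbf{X}_j))_{i,j=1}^n$; $Q$ is the diagonal matrix with $Q_{ii}=q(\|\Phi(\mathbf{X}_i)-f_{F_n}\|_{\mathcal{H}})/\|\Phi(\mathbf{X}_i)-f_{F_n}\|_{\mathcal{H}}^3$; $\gamma=\sum_{i=1}^n\varphi(\|\Phi(\mathbf{X}_i)-f_{F_n}\|_{\mathcal{H}})$; and $\mathbf{w}=[w_1,\dots,w_n]^T$ is the vector of RKDE weights, i.e. $f_{F_n}=\sum_{i=1}^n w_i\Phi(\mathbf{X}_i)$ with $w_i\ge0$, $\sum_i w_i=1$ and $w_i\propto\varphi(\|\Phi(\mathbf{X}_i)-f_{F_n}\|_{\mathcal{H}})$.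
   Formalization: The linear system for α is assumed to have a unique solution (it can be singular under the listed assumptions, and then the influence function may not exist); ψ is assumed differentiable at each positive ‖Φ(X_i) − f_{F_n}‖, so that Q is defined. *)

(* Defs.v *)
From HB Require Import structures.
From mathcomp Require Import all_boot all_order all_algebra.
From mathcomp Require Import all_classical all_reals all_analysis.

Set Implicit Arguments.
Unset Strict Implicit.
Unset Printing Implicit Defensive.

Import Order.TTheory GRing.Theory Num.Theory.
Import numFieldNormedType.Exports.

Local Open Scope classical_set_scope.
Local Open Scope ring_scope.

(* R^d is d.-tuple R with the product (= Borel) sigma-algebra.  Its Lebesgue
   measure is not in the library: it is built by induction on d as the image of
   the product of the one-dimensional measure with the (d-1)-dimensional one. *)
Section lebesgue_tuple.
Context {R : realType}.

Definition tcons d (p : measurableTypeR R * d.-tuple R) : d.+1.-tuple R :=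
  [tuple of p.1 :: p.2].

Lemma measurable_tcons d : measurable_fun setT (@tcons d).
Proof.
exact: (@measurable_cons _ _ (measurableTypeR R * d.-tuple R)%type R fst d snd).
Qed.

Section step.
Variables (d : nat) (m : {sigma_finite_measure set (d.-tuple R) -> \bar R}).

Definition lebesgue_tupleS : set (d.+1.-tuple R) -> \bar R :=
  pushforward (@lebesgue_measure R \x m)%E (@tcons d).

Let image_measure :=
  measure_function_pushforward__canonical__measure_function_Measure
    (@lebesgue_measure R \x m)%E (@measurable_tcons d).

Let lebesgue_tupleS0 : lebesgue_tupleS set0 = 0%E.
Proof. exact: (measure0 image_measure). Qed.

Let lebesgue_tupleS_ge0 A : (0 <= lebesgue_tupleS A)%E.
Proof. exact: (measure_ge0 image_measure). Qed.

Let lebesgue_tupleS_sigma_additive : semi_sigma_additive lebesgue_tupleS.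
Proof. exact: (@measure_semi_sigma_additive _ _ _ image_measure). Qed.

HB.instance Definition _ := isMeasure.Build _ _ _ lebesgue_tupleS
  lebesgue_tupleS0 lebesgue_tupleS_ge0 lebesgue_tupleS_sigma_additive.

Let lebesgue_tupleS_sigma_finite : sigma_finite setT lebesgue_tupleS.
Proof.
pose mu := @lebesgue_measure R.
have /sigma_finiteP[F [FT ndF Foo]] := sigma_finiteT mu.
have /sigma_finiteP[G [GT ndG Goo]] := sigma_finiteT m.
pose unc (t : d.+1.-tuple R) : measurableTypeR R * d.-tuple R :=
  (thead t, [tuple of behead t]).
have munc : measurable_fun setT unc.
  apply/measurable_fun_pairP; split; last exact: measurable_behead.
  exact: (measurable_tnth ord0).
have tconsK : cancel (@tcons d) unc.
  by move=> [x t]; congr pair; exact: val_inj.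
exists (fun n => unc @^-1` (F n `*` G n)).
  apply/esym; rewrite -subTset => t _.
  have [i _ Fi] : (\bigcup_i F i) (unc t).1 by rewrite -FT.
  have [j _ Gj] : (\bigcup_i G i) (unc t).2 by rewrite -GT.
  exists (maxn i j) => //; split.
    by move: Fi; apply/subsetPset/ndF/leq_maxl.
  by move: Gj; apply/subsetPset/ndG/leq_maxr.
move=> n; have [mF ltF] := Foo n; have [mG ltG] := Goo n; split.
  by rewrite -[X in measurable X]setTI; apply: munc => //; exact: measurableX.
rewrite /lebesgue_tupleS /pushforward -comp_preimage.
rewrite (_ : unc \o @tcons d = id) ?preimage_id; last exact/funext.
by rewrite product_measure1E// lte_mul_pinfty// ge0_fin_numE.
Qed.

HB.instance Definition _ := Measure_isSigmaFinite.Build _ _ _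
  lebesgue_tupleS lebesgue_tupleS_sigma_finite.

End step.

Fixpoint lebesgue_tuple d : {sigma_finite_measure set (d.-tuple R) -> \bar R} :=
  if d is d'.+1 then lebesgue_tupleS (lebesgue_tuple d') else \d_[tuple].

End lebesgue_tuple.

Definition symmetric_mx (R : realType) m (A : 'M[R]_m) := A^T = A.

Definition pos_semidef_mx (R : realType) m (A : 'M[R]_m) :=
  symmetric_mx A /\ forall v : 'cV[R]_m, 0 <= (v^T *m A *m v) 0 0.

Definition pos_def_mx (R : realType) m (A : 'M[R]_m) :=
  symmetric_mx A /\ forall v : 'cV[R]_m, v != 0 -> 0 < (v^T *m A *m v) 0 0.

Definition kernel_mx (R : realType) (T : Type) (k : T -> T -> R) m
    (X : 'I_m -> T) : 'M[R]_m :=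
  \matrix_(i, j) k (X i) (X j).

Definition extend_points (T : Type) m (X : 'I_m -> T) (x' : T) : 'I_m.+1 -> T :=
  fun i => if unlift ord_max i is Some j then X j else x'.

(* The norm of the library on vectors is the sup norm, hence an explicit
   Euclidean distance. *)
Definition sqdist (R : realType) d (x y : d.-tuple R) : R :=
  \sum_(i < d) (tnth x i - tnth y i) ^+ 2.

Record smoothing_kernel (R : realType) d (k : d.-tuple R -> d.-tuple R -> R) :
    Prop := {
  kernel_ge0 : forall x y, 0 <= k x y ;
  kernel_measurable : forall x, measurable_fun setT (k x) ;
  kernel_integral : forall x, (\int[lebesgue_tuple d]_y (k x y)%:E = 1)%E ;
  kernel_radial : exists g0 : R -> R, forall x y, k x y = g0 (sqdist x y) ;
  kernel_psd : forall m (X : 'I_m -> d.-tuple R), pos_semidef_mx (kernel_mx k X)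
}.

(* The elements of the Hilbert space stand for functions on T through the
   injection [rkhs_eval]; the reproducing property makes it linear. *)
Record rkhs (R : realType) (T : Type) (k : T -> T -> R) := {
  rkhs_space :> completeNormedModType R ;
  rkhs_dot : {dot rkhs_space for idfun} ;
  rkhs_norm_dot : forall g : rkhs_space, `|g| ^+ 2 = rkhs_dot g g ;
  rkhs_eval : rkhs_space -> T -> R ;
  rkhs_eval_inj : injective rkhs_eval ;
  rkhs_feature : T -> rkhs_space ;
  rkhs_featureE : forall x y, rkhs_eval (rkhs_feature x) y = k y x ;
  rkhs_reproducing : forall g x, rkhs_eval g x = rkhs_dot (rkhs_feature x) g
}.

Section loss.
Variables (R : realType) (rho : R -> R).

(* rho is a function on [0, +oo[: its values at negative reals are never used,
   and its derivative at 0 is the one-sided one. *)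
Definition loss_differentiable :=
  (forall x, 0 < x -> derivable rho x 1) /\
  cvg ((rho h - rho 0) / h @[h --> 0^'+]).

Definition psi (x : R) : R :=
  if 0 < x then derive1 rho x else lim ((rho h - rho 0) / h @[h --> 0^'+]).

Definition phi (x : R) : R :=
  if 0 < x then psi x / x else lim (psi t / t @[t --> 0^'+]).

Definition q (x : R) : R := x * derive1 psi x - psi x.

Record loss_assumptions : Prop := {
  loss_ndecr : {in `[0, +oo[ &, {homo rho : x y / x <= y}} ;
  loss0 : rho 0 = 0 ;
  loss_div_cvg0 : rho x / x @[x --> 0^'+] --> 0 ;
  phi0_cvg : cvg (psi x / x @[x --> 0^'+]) ;
  psi_continuous : {within `[0, +oo[%classic, continuous psi} ;
  phi_continuous : {within `[0, +oo[%classic, continuous phi} ;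
  psi_bounded : [bounded psi x | x in `[0, +oo[%classic] ;
  phi_bounded : [bounded phi x | x in `[0, +oo[%classic] ;
  phi_lipschitz : [lipschitz phi x | x in `[0, +oo[%classic]
}.

End loss.

Section contamination.
Context dT (T : measurableType dT) (R : realType).
Local Open Scope ereal_scope.

Section empirical.
Variables (n : nat) (X : 'I_n.+1 -> T).

Definition empirical (A : set T) : \bar R :=
  (n.+1%:R^-1)%R%:E * \sum_(i < n.+1) \d_(X i) A.

Let sum_dirac : {measure set T -> \bar R} :=
  msum (fun i => \d_(X (inord i)) : {measure set T -> \bar R}) n.+1.

Let inv_ge0 : (0 <= n.+1%:R^-1 :> R)%R.
Proof. by rewrite invr_ge0 ler0n. Qed.

Let empiricalE : empirical = mscale (NngNum inv_ge0) sum_dirac.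
Proof.
apply/funext => A; rewrite /empirical /mscale /= /msum; congr (_ * _).
by apply: eq_bigr => i _; rewrite inord_val.
Qed.

Let empirical0 : empirical set0 = 0.
Proof. by rewrite empiricalE measure0. Qed.

Let empirical_ge0 A : 0 <= empirical A.
Proof. by rewrite empiricalE measure_ge0. Qed.

Let empirical_sigma_additive : semi_sigma_additive empirical.
Proof. by rewrite empiricalE; exact: measure_semi_sigma_additive. Qed.

HB.instance Definition _ := isMeasure.Build _ _ _ empirical
  empirical0 empirical_ge0 empirical_sigma_additive.

Let empirical_setT : empirical setT = 1.
Proof.
rewrite /empirical (eq_bigr (fun=> 1%:E)); last by move=> i _; rewrite diracT.
by rewrite sumEFin -EFinM sumr_const card_ord mulVf// pnatr_eq0.
Qed.

HB.instance Definition _ := Measure_isProbability.Build _ _ _ empirical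
  empirical_setT.

End empirical.

Section contaminated.
Variables (F : probability T R) (x : T) (s : R).

(* [clamp01] is the identity on [0, 1], the range of contamination levels; it
   makes the mixture a probability for every real s. *)
Definition clamp01 : R := Num.max 0%R (Num.min s 1%R).

Definition contaminated (A : set T) : \bar R :=
  (1 - clamp01)%R%:E * F A + clamp01%:E * \d_x A.

Let clamp01_ge0 : (0 <= clamp01)%R.
Proof. by rewrite le_max lexx. Qed.

Let clamp01_le1 : (0 <= 1 - clamp01)%R.
Proof. by rewrite subr_ge0 ge_max ler01 ge_min lexx orbT. Qed.

Let contaminatedE : contaminated =
  measure_add (mscale (NngNum clamp01_le1) F) (mscale (NngNum clamp01_ge0) \d_x).
Proof. by apply/funext => A; rewrite measure_addE. Qed.

Let contaminated0 : contaminated set0 = 0.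
Proof. by rewrite contaminatedE /measure_add measure0. Qed.

Let contaminated_ge0 A : 0 <= contaminated A.
Proof. by rewrite contaminatedE /measure_add measure_ge0. Qed.

Let contaminated_sigma_additive : semi_sigma_additive contaminated.
Proof. by rewrite contaminatedE /measure_add; exact: measure_semi_sigma_additive. Qed.

HB.instance Definition _ := isMeasure.Build _ _ _ contaminated
  contaminated0 contaminated_ge0 contaminated_sigma_additive.

Let contaminated_setT : contaminated setT = 1.
Proof.
by rewrite /contaminated probability_setT diracT !mule1 -EFinD subrK.
Qed.

HB.instance Definition _ := Measure_isProbability.Build _ _ _ contaminated
  contaminated_setT.

End contaminated.

End contamination.

Section influence.
Context dT (T : measurableType dT) (R : realType).
Variables (S : T -> probability T R -> R) (F : probability T R) (x x' : T).

Definition influence_quotient (s : R) : R :=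
  (S x (contaminated F x' s) - S x F) / s.

(* As s ranges over [0, 1), the limit at 0 is from the right. *)
Definition influence_exists := cvg (influence_quotient s @[s --> 0^'+]).

Definition influence_function : R := lim (influence_quotient s @[s --> 0^'+]).

End influence.

Section rkde.
Context dT (T : measurableType dT) (R : realType).
Variables (k : T -> T -> R) (H : rkhs k) (rho : R -> R).

Definition rkde_objective (mu : probability T R) (g : H) : \bar R :=
  \int[mu]_x (rho `|rkhs_feature H x - g|)%:E.

Definition rkde_argmin (mu : probability T R) (f : H) :=
  forall g : H, (rkde_objective mu f <= rkde_objective mu g)%E.

Definition rkde (f : probability T R -> H) (x : T) (mu : probability T R) : R :=
  rkhs_eval (f mu) x.

(* "w_i proportional to phi(...)" together with the normalization forces the
   sum of the phi(...) to be nonzero. *)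
Record rkde_weights n (X : 'I_n -> T) (f : H) (w : 'cV[R]_n) : Prop := {
  rkde_weights_sum : f = \sum_(i < n) w i 0 *: rkhs_feature H (X i) ;
  rkde_weights_ge0 : forall i, 0 <= w i 0 ;
  rkde_weights1 : \sum_(i < n) w i 0 = 1 ;
  rkde_weights_prop : exists c : R,
    forall i, w i 0 = c * phi rho `|rkhs_feature H (X i) - f|
}.

End rkde.

(* Main.v *)
Require Import Defs.
From mathcomp Require Import all_boot all_order all_algebra.
From mathcomp Require Import all_classical all_reals all_analysis.
From mathcomp Require Import measurable_realfun ring lra.

Import Order.TTheory GRing.Theory Num.Theory.
Import numFieldNormedType.Exports.

Local Open Scope classical_set_scope.
Local Open Scope ring_scope.

(* Write f_s for the minimizer at contamination level s, p_i for Phi(X_i) - f_0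
   and h_s for (f_s - f_0)/s.  Subtracting the first-order conditions at s and
   at 0, and replacing each increment of phi by an exact difference quotient,
   shows that h_s solves a linear equation whose operator, a multiple of the
   identity plus a finite-rank map, converges to
     L h = gamma h + sum_i Q_ii <p_i, h> p_i .
   Pairing this equation with the vectors spanning the finite-rank part gives an
   n x n system with converging coefficients.  Uniqueness of alpha makes the
   limit matrix gamma I + (M K M^T) Q invertible, since gamma I + Y Z is
   injective as soon as gamma I + Z Y is.  Hence Cramer's rule yields the limit
   of h_s, and the system satisfied by alpha says that
   sum_i alpha_i Phi(X_i) + alpha' Phi(x') is the solution of L h = n phi(r') (Phi(x') - f_0). *)

(** * Limits of determinants and of solutions of linear systems *)

Section matrix_limits.
Context {R : realType} {T : Type} {F : set_system T} {FF : Filter F}.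

Lemma cvg_sumr (I : Type) (r : seq I) (P : pred I) (u : I -> T -> R) (l : I -> R) :
  (forall i, P i -> u i s @[s --> F] --> l i) ->
  \sum_(i <- r | P i) u i s @[s --> F] --> \sum_(i <- r | P i) l i.
Proof. by apply: cvg_big; exact: add_continuous. Qed.

Lemma cvg_prodr (I : Type) (r : seq I) (P : pred I) (u : I -> T -> R) (l : I -> R) :
  (forall i, P i -> u i s @[s --> F] --> l i) ->
  \prod_(i <- r | P i) u i s @[s --> F] --> \prod_(i <- r | P i) l i.
Proof. by apply: cvg_big; exact: mul_continuous. Qed.

Lemma cvg_det n (A : T -> 'M[R]_n) (B : 'M[R]_n) :
  (forall i j, A s i j @[s --> F] --> B i j) -> \det (A s) @[s --> F] --> \det B.
Proof.
move=> AB; apply: cvg_sumr => p _; apply: cvgM; first exact: cvg_cst.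
by apply: cvg_prodr => i _; exact: AB.
Qed.

(** By Cramer's rule a solution is a rational function of the coefficients, whose denominator is
    eventually nonzero because [\det B != 0]. No a priori bound on [u] is required. *)
Lemma cvg_linear_system n (A : T -> 'M[R]_n) (B : 'M[R]_n)
    (b u : T -> 'cV[R]_n) (c v : 'cV[R]_n) :
  \det B != 0 -> B *m v = c ->
  (forall i j, A s i j @[s --> F] --> B i j) ->
  (forall i, b s i 0 @[s --> F] --> c i 0) ->
  (\forall s \near F, A s *m u s = b s) ->
  forall i, u s i 0 @[s --> F] --> v i 0.
Proof.
move=> B0 Bv AB bc Au i.
have cramer (D : 'M[R]_n) (w e : 'cV[R]_n) : \det D != 0 -> D *m w = e ->
    w i 0 = (\det D)^-1 * \sum_j \adj D i j * e j 0.
  move=> D0 De; have /matrixP/(_ i 0) : \adj D *m e = \det D *: w.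
    by rewrite -De mulmxA mul_adj_mx mul_scalar_mx.
  by rewrite !mxE => ->; rewrite mulKf.
have dA : \det (A s) @[s --> F] --> \det B by exact: cvg_det.
rewrite (cramer _ _ _ B0 Bv).
apply: (@cvg_trans _ ((\det (A s))^-1 * \sum_j \adj (A s) i j * b s j 0 @[s --> F])).
  apply: near_eq_cvg; have dA0 := cvgr_neq0 _ dA B0.
  near=> s; apply: esym; apply: cramer; [near: s; exact: dA0 | near: s; exact: Au].
apply: cvgM; first exact: cvgV.
apply: cvg_sumr => j _; apply: cvgM; last exact: bc.
rewrite mxE /cofactor; under eq_cvg do rewrite mxE /cofactor.
apply: cvgM; first exact: cvg_cst.
by apply: cvg_det => k l; rewrite !mxE; under eq_cvg do rewrite !mxE; exact: AB.
Unshelve. all: by end_near. Qed.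

End matrix_limits.

(** * Real inner products that induce the norm *)

Section inner_product.
Context {R : realType} {V : normedModType R} (dot : {dot V for idfun}).
Hypothesis norm_dot : forall g : V, `|g| ^+ 2 = dot g g.

Lemma dotC x y : dot x y = dot y x.
Proof. by rewrite hermC expr0 mul1r. Qed.

Lemma dotDl x y z : dot (x + y) z = dot x z + dot y z.
Proof. exact: linearDl. Qed.

Lemma dotZl a x y : dot (a *: x) y = a * dot x y.
Proof. by rewrite linearZl. Qed.

Lemma dotDr x y z : dot x (y + z) = dot x y + dot x z.
Proof. by rewrite !(dotC x) dotDl. Qed.

Lemma dotZr a x y : dot x (a *: y) = a * dot x y.
Proof. by rewrite !(dotC x) dotZl. Qed.

Lemma dotNl x y : dot (- x) y = - dot x y.
Proof. by rewrite -scaleN1r dotZl mulN1r. Qed.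

Lemma dotNr x y : dot x (- y) = - dot x y.
Proof. by rewrite !(dotC x) dotNl. Qed.

Lemma dot0r x : dot x 0 = 0.
Proof. by rewrite -(scale0r 0) dotZr mul0r. Qed.

Lemma dot_sumr (I : Type) (r : seq I) (P : pred I) (u : I -> V) x :
  dot x (\sum_(i <- r | P i) u i) = \sum_(i <- r | P i) dot x (u i).
Proof.
by elim/big_rec2: _ => [|i y z _ <-]; [exact: dot0r | rewrite dotDr].
Qed.

Lemma dot_suml (I : Type) (r : seq I) (P : pred I) (u : I -> V) x :
  dot (\sum_(i <- r | P i) u i) x = \sum_(i <- r | P i) dot (u i) x.
Proof. by rewrite dotC dot_sumr; apply: eq_bigr => i _; rewrite dotC. Qed.

Lemma polarization x y : dot x y = 2^-1 * (`|x + y| ^+ 2 - `|x| ^+ 2 - `|y| ^+ 2).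
Proof. rewrite !norm_dot dotDl !dotDr (dotC y x); lra. Qed.

Lemma dotDB x y : dot (x + y) (x - y) = `|x| ^+ 2 - `|y| ^+ 2.
Proof. by rewrite !norm_dot dotDl !dotDr !dotNr (dotC y x); ring. Qed.

(** Polarization reduces the joint continuity of [dot] to the continuity of the norm. *)
Lemma cvg_dot {T : Type} {F : set_system T} {FF : Filter F} (u v : T -> V) x y :
  u s @[s --> F] --> x -> v s @[s --> F] --> y -> dot (u s) (v s) @[s --> F] --> dot x y.
Proof.
move=> ux vy; rewrite polarization; under eq_cvg do rewrite polarization.
have sqr w z : w s @[s --> F] --> z -> `|w s| ^+ 2 @[s --> F] --> `|z : V| ^+ 2.
  by move=> wz; apply: cvgM; exact: cvg_norm.
apply: cvgM; first exact: cvg_cst.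
by apply: cvgB; [apply: cvgB; apply: sqr => //; exact: cvgD|exact: sqr].
Qed.

(* Caratheodory's form of the derivative of [F `|y - g|] in [g]; it is exact, so
   that it can be used along a path of which no derivative is known. *)
Lemma norm_slope (F : R -> R) (a : R) (y f : V) :
  0 < `|y - f| -> is_derive `|y - f| 1 F a ->
  exists D : V -> R,
    (forall g, F `|y - g| - F `|y - f| = - (D g * dot ((y - f) + (y - g)) (g - f)))
    /\ D g @[g --> f] --> a / (2 * `|y - f|).
Proof.
move=> r0 /is_derive1_caratheodory[S [FS cS Sa]].
(* [S] is the slope of [F] between the two norms. A difference of norms is the difference of their
   squares, which [dotDB] turns into an inner product, divided by their sum. *)
exists (fun g => S `|y - g| / (`|y - g| + `|y - f|)); split=> [g|].
  rewrite FS.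
  have -> : dot (y - f + (y - g)) (g - f) = `|y - f| ^+ 2 - `|y - g| ^+ 2.
    by rewrite -dotDB; congr (dot _ _); rewrite opprB [RHS]addrC addrA subrK.
  have : `|y - g| + `|y - f| != 0 by rewrite gt_eqF// ltr_wpDl.
  by move=> ?; field.
have cn : `|y - g| @[g --> f] --> `|y - f|.
  by apply: cvg_norm; apply: cvgB; [exact: cvg_cst|exact: cvg_id].
apply: cvgM; first by rewrite -Sa; exact: (cvg_comp _ _ cn cS).
rewrite (_ : 2 * _ = `|y - f| + `|y - f|); last by ring.
apply: cvgV; first by rewrite gt_eqF// addr_gt0.
by apply: cvgD => //; exact: cvg_cst.
Qed.

End inner_product.

(** * Integration against finite weighted sums of point masses *)

Lemma finite_set_measurable d (T : measurableType d) (A : set T) :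
  (forall x : T, measurable [set x]) -> finite_set A -> measurable A.
Proof.
move=> m1 fA; rewrite -[A]image_id -bigcup_imset1.
by apply: fin_bigcup_measurable.
Qed.

Lemma measurable_set1_tuple (R : realType) d (x : d.-tuple R) :
  measurable [set x].
Proof.
rewrite (_ : [set x] = \bigcap_(i in [set: 'I_d])
    ((fun t : d.-tuple R => tnth t i) @^-1` [set tnth x i])).
  apply: fin_bigcap_measurable; first exact: finite_finset.
  move=> i _; rewrite -[X in measurable X]setTI.
  by apply: measurable_tnth => //; exact: measurable_set1.
apply/seteqP; split=> [t -> i //|t tx]; apply: eq_from_tnth => i; exact: (tx i).
Qed.

Import HBNNSimple.

Section integral_diracs.
Context dT (T : measurableType dT) (R : realType).
Hypothesis m1 : forall x : T, measurable [set x].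
Variables (mu : {measure set T -> \bar R}) (N : nat) (a : 'I_N -> R) (y : 'I_N -> T).
Hypothesis a0 : forall i, 0 <= a i.
Hypothesis mu_diracs : forall A, measurable A ->
  mu A = (\sum_i (a i)%:E * \d_(y i) A)%E.

(** [msum] takes a family indexed by [nat], so the finite family is padded with the zero measure. *)
Let summand (k : nat) : {measure set T -> \bar R} :=
  oapp (fun i => mscale (NngNum (a0 i)) \d_(y i) : {measure set T -> \bar R})
    mzero (insub k).

Lemma integral_diracs_measurable (f : T -> R) : measurable_fun setT f ->
  (forall x, 0 <= f x) -> (\int[mu]_x (f x)%:E = (\sum_i a i * f (y i))%:E)%E.
Proof.
move=> mf f0; have mEf : measurable_fun setT (EFin \o f) by exact/measurable_EFinP.
have summandE (i : 'I_N) : summand i = mscale (NngNum (a0 i)) \d_(y i).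
  by rewrite /summand valK.
rewrite (eq_measure_integral (msum summand N)); last first.
  move=> A mA _; rewrite [LHS]mu_diracs// /msum.
  by apply: eq_bigr => i _; rewrite summandE.
rewrite ge0_integral_measure_sum//; last by move=> x _; rewrite lee_fin.
rewrite -sumEFin; apply: eq_bigr => i _; rewrite summandE.
rewrite ge0_integral_mscale//; last by move=> x _; rewrite lee_fin.
by rewrite integral_dirac// diracT mul1e EFinM.
Qed.

(* No measurability is asked of [f]: the feature map is not known to be measurable. *)
Lemma integral_diracs (f : T -> R) : (forall x, 0 <= f x) ->
  (\int[mu]_x (f x)%:E = (\sum_i a i * f (y i))%:E)%E.
Proof.
move=> f0; apply/eqP; rewrite eq_le; apply/andP; split.
  (* Upper bound: the integral is a supremum over simple functions below [f], and these are
     measurable. *)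
  rewrite ge0_integralTE; last by move=> x; rewrite lee_fin.
  apply: ge_ereal_sup => _ [h /= hf <-].
  rewrite -integralT_nnsfun integral_diracs_measurable//.
  rewrite lee_fin; apply: ler_sum => i _; apply: ler_wpM2l => //.
  by rewrite -lee_fin.
(* Lower bound: cutting [f] off outside the finite set of atoms makes it measurable without changing
   its values at the atoms. *)
pose S := range y.
have mS B : B `<=` S -> measurable B.
  move=> BS; apply: finite_set_measurable => //; apply: sub_finite_set BS _.
  exact/finite_image/finite_finset.
have g0 x : 0 <= (f \_ S) x by rewrite /patch; case: ifP.
have -> : \sum_i a i * f (y i) = \sum_i a i * (f \_ S) (y i).
  apply: eq_bigr => i _; rewrite /patch ifT// inE; exact: imageT.
rewrite -integral_diracs_measurable//; last first.
  apply/(measurable_restrictT (D := S) _ _); first exact: mS.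
  by move=> _ B _; apply: mS => x [].
rewrite !ge0_integralTE//; [|by move=> x; rewrite lee_fin ..].
apply: le_ereal_sup => _ [h /= hf <-]; exists h => //= x.
apply: (le_trans (hf x)); rewrite lee_fin /patch; case: ifP => //.
Qed.

End integral_diracs.

(** * Derivatives of the loss and first-order conditions *)

Section loss_theory.
Context {R : realType} {rho : R -> R}.
Hypotheses (hrho : loss_differentiable rho) (hA : loss_assumptions rho).

Lemma rho_ge0 x : 0 <= x -> 0 <= rho x.
Proof.
move=> x0; rewrite -(loss0 hA); apply: (loss_ndecr hA) => //.
  by rewrite in_itv/= lexx.
by rewrite in_itv/= andbT.
Qed.

Lemma is_derive_rho (x : R) : 0 < x -> is_derive x 1 rho (psi rho x).
Proof.
by move=> x0; rewrite /psi x0 derive1E; apply: derivableP; exact: hrho.1.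
Qed.

(** Quotient rule: [q] is exactly the numerator of the derivative of [psi x / x]. *)
Lemma is_derive_phi (r : R) : 0 < r -> derivable (psi rho) r 1 ->
  is_derive r 1 (phi rho) (q rho r / r ^+ 2).
Proof.
move=> r0 dpsi; apply: (@near_eq_is_derive _ _ _ (fun x => psi rho x * x^-1)).
  have := lt_nbhsr r0; apply: filterS => x x0.
  by rewrite /phi x0.
apply: is_derive_eq.
  apply: is_deriveM; first exact: derivableP.
  by apply: is_deriveV; rewrite gt_eqF.
rewrite /q derive1E /GRing.scale/=.
have : r != 0 by rewrite gt_eqF.
by move=> ?; field.
Qed.

(** Continuity of [phi] is only relative to [[0, +oo[], hence the sign conditions on the path and on
    its limit. *)
Lemma phi_cvg {T : Type} {F : set_system T} {FF : Filter F} (u : T -> R) (l : R) :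
  (forall s, 0 <= u s) -> 0 <= l -> u s @[s --> F] --> l ->
  phi rho (u s) @[s --> F] --> phi rho l.
Proof.
move=> u0 l0 ul.
have l0' : `[0, +oo[%classic l by rewrite /= in_itv/= l0.
have /subspace_continuousP/(_ _ l0') cphi := phi_continuous hA.
apply: (cvg_comp u (phi rho) _ cphi) => A.
rewrite /within/= !nbhs_filterE => nA.
have : F (u @^-1` [set x | `[0, +oo[%classic x -> A x]) := ul _ nA.
by apply: filterS => s /=; apply; rewrite in_itv/= u0.
Qed.

Context {V : normedModType R} (dot : {dot V for idfun}).
Hypothesis norm_dot : forall g : V, `|g| ^+ 2 = dot g g.

(** For [y] distinct from [f] this is the chain rule, through [norm_slope]. For [y = f], where the
    norm has a kink, [rho x / x] tending to 0 makes both sides vanish. *)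
Lemma loss_directional_derivative (y f v : V) :
  (rho `|y - (f + t *: v)| - rho `|y - f|) / t @[t --> 0^'+] -->
    - (phi rho `|y - f| * dot (y - f) v).
Proof.
have [r0|] := ltP 0 `|y - f|; last first.
  rewrite normr_le0 => /eqP yf0; rewrite yf0 normr0 (loss0 hA).
  have -> : - (phi rho 0 * dot 0 v) = 0 by rewrite dotC dot0r mulr0 oppr0.
  rewrite (_ : (fun t => _) = (fun t => rho `|t *: v| / t)); last first.
    by apply/funext => t; rewrite opprD addrA yf0 sub0r normrN subr0.
  have [v0|v0] := eqVneq v 0.
    rewrite (_ : (fun t => _) = cst 0); first exact: cvg_cst.
    by apply/funext => t; rewrite v0 scaler0 normr0 (loss0 hA) mul0r.
  have nv0 : 0 < `|v| by rewrite normr_gt0.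
  have tv0 : t * `|v| @[t --> 0^'+] --> (0 : R)^'+.
    have tv0 : t * `|v| @[t --> 0^'+] --> (0 : R).
      rewrite -[X in _ --> X](mul0r `|v|); apply: cvgM; last exact: cvg_cst.
      exact: cvg_at_right_filter cvg_id.
    move=> A nA.
    have tA : ((0 : R)^'+) (fun t => 0 < t * `|v| -> A (t * `|v|)) := tv0 _ nA.
    have := nbhs_right_gt (0 : R); apply: filterS2 tA => t At t0.
    by apply: At; rewrite mulr_gt0.
  have lim0 : rho (t * `|v|) / (t * `|v|) * `|v| @[t --> 0^'+] --> 0 * `|v|.
    apply: cvgM; last exact: cvg_cst.
    exact: (cvg_comp _ (fun x => rho x / x) tv0 (loss_div_cvg0 hA)).
  rewrite mul0r in lim0; apply: cvg_trans lim0.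
  apply: near_eq_cvg; near=> t.
  have t0 : 0 < t by near: t; exact: nbhs_right_gt.
  rewrite normrZ gtr0_norm//.
  have : t != 0 by rewrite gt_eqF.
  have : `|v| != 0 by rewrite gt_eqF.
  by move=> ? ?; field; apply/andP.
have [D [Deq Dcvg]] := norm_slope _ norm_dot _ _ _ _ r0 (is_derive_rho _ r0).
have cf : f + t *: v @[t --> 0^'+] --> f.
  rewrite -[X in _ --> X]addr0 -(scale0r v); apply: cvgD; first exact: cvg_cst.
  by apply: cvgZr_tmp; exact: cvg_at_right_filter cvg_id.
have -> : phi rho `|y - f| * dot (y - f) v =
    psi rho `|y - f| / (2 * `|y - f|) * dot (y - f + (y - f)) v.
  rewrite /phi r0 (dotDl _ (y - f) (y - f)); field.
  by rewrite gt_eqF.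
have lim_slope : - (D (f + t *: v) * dot (y - f + (y - (f + t *: v))) v)
    @[t --> 0^'+] --> - (psi rho `|y - f| / (2 * `|y - f|) * dot (y - f + (y - f)) v).
  apply: cvgN; apply: cvgM; first exact: (cvg_comp _ _ cf Dcvg).
  apply: (cvg_dot _ norm_dot); last exact: cvg_cst.
  by apply: cvgD; [exact: cvg_cst|apply: cvgB => //; exact: cvg_cst].
apply: cvg_trans lim_slope; apply: near_eq_cvg; near=> t.
have t0 : t != 0 by rewrite gt_eqF//; near: t; exact: nbhs_right_gt.
rewrite Deq [f + t *: v - f]addrC addKr dotZr.
by field.
Unshelve. all: by end_near. Qed.

(** One direction is enough, namely the sum [v] itself: the one-sided derivative along it is minus
    the squared norm of [v], and minimality makes it nonnegative. *)
Lemma argmin_first_order (N : nat) (a : 'I_N -> R) (y : 'I_N -> V) (f : V) :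
  (forall g, \sum_i a i * rho `|y i - f| <= \sum_i a i * rho `|y i - g|) ->
  \sum_i (a i * phi rho `|y i - f|) *: (y i - f) = 0.
Proof.
move=> fmin; set v := \sum_i _.
have lim_quotient : \sum_i a i * ((rho `|y i - (f + t *: v)| - rho `|y i - f|) / t)
    @[t --> 0^'+] --> - `|v| ^+ 2.
  rewrite norm_dot {2}/v dot_suml -sumrN.
  apply: cvg_sumr => i _; rewrite dotZl -mulrA -mulrN.
  by apply: cvgM; [exact: cvg_cst|exact: loss_directional_derivative].
have : 0 <= - `|v| ^+ 2.
  rewrite -(cvg_lim _ lim_quotient)//; apply: limr_ge.
    by apply/cvg_ex; eexists; exact: lim_quotient.
  near=> t.
  have t0 : 0 < t by near: t; exact: nbhs_right_gt.
  under eq_bigr do rewrite mulrA mulrBr.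
  by rewrite -mulr_suml mulr_ge0 ?invr_ge0 ?(ltW t0)// sumrB subr_ge0; exact: fmin.
rewrite oppr_ge0 => v0; apply/eqP.
by rewrite -normr_eq0 -sqrf_eq0 eq_le v0 sqr_ge0.
Unshelve. all: by end_near. Qed.

End loss_theory.

(** * Derivative of the path of minimizers *)

Section linearization.
Context {R : realType} {rho : R -> R}.
Hypothesis hA : loss_assumptions rho.
Context {V : normedModType R} (dot : {dot V for idfun}).
Hypothesis norm_dot : forall g : V, `|g| ^+ 2 = dot g g.

(** The factor [y - f] lets the formula include the case [y = f], where [phi] need not be
    differentiable. *)
Lemma phi_norm_slope (y f : V) :
  (0 < `|y - f| -> derivable (psi rho) `|y - f| 1) ->
  exists D : V -> R,
    (forall g, phi rho `|y - g| *: (y - f) = phi rho `|y - f| *: (y - f)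
       - (D g * dot ((y - f) + (y - g)) (g - f)) *: (y - f))
    /\ D g @[g --> f] --> 2^-1 * (q rho `|y - f| / `|y - f| ^+ 3).
Proof.
move=> dpsi; have [r0|] := ltP 0 `|y - f|; last first.
  rewrite normr_le0 => /eqP yf0; exists (fun=> 0); split=> [g|].
    by rewrite yf0 !scaler0 subr0.
  (* Since the inverse of 0 is 0, the stated limit is 0 here, in agreement with the witness
     [D = 0]. *)
  by rewrite yf0 normr0 expr0n/= invr0 !mulr0; exact: cvg_cst.
have [D [Deq Dcvg]] := norm_slope _ norm_dot _ _ _ _ r0
  (is_derive_phi _ r0 (dpsi r0)).
exists D; split=> [g|].
  by rewrite -scalerBl; congr (_ *: _); have := Deq g; lra.
have -> : 2^-1 * (q rho `|y - f| / `|y - f| ^+ 3) =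
    q rho `|y - f| / `|y - f| ^+ 2 / (2 * `|y - f|) by field; rewrite gt_eqF.
exact: Dcvg.
Qed.

Variables (N : nat) (y : 'I_N -> V) (y' f0 : V) (fs : R -> V).

Let p i := y i - f0.
Let Q i := q rho `|p i| / `|p i| ^+ 3.
Let gamma := \sum_i phi rho `|p i|.

Hypothesis N0 : (0 < N)%N.
Hypothesis gamma0 : gamma != 0.
Hypothesis dpsi : forall i, 0 < `|p i| -> derivable (psi rho) `|p i| 1.
Hypothesis fs_cvg : fs s @[s --> 0^'+] --> f0.
Hypothesis f0_crit : \sum_i phi rho `|p i| *: p i = 0.
Hypothesis fs_crit : forall s, 0 < s < 1 ->
  \sum_i ((1 - s) / N%:R * phi rho `|y i - fs s|) *: (y i - fs s)
  + (s * phi rho `|y' - fs s|) *: (y' - fs s) = 0.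
Hypothesis nondegenerate : forall u : 'cV[R]_N,
  (forall i, gamma * u i 0 + \sum_j Q j * dot (p i) (p j) * u j 0 = 0) -> u = 0.

Lemma solution_path_derivative (h0 z : V) :
  gamma *: h0 + \sum_j (Q j * dot (p j) h0) *: p j
    = (N%:R * phi rho `|y' - f0|) *: (y' - f0) ->
  dot z (s^-1 *: (fs s - f0)) @[s --> 0^'+] --> dot z h0.
Proof.
move=> h0E.
have [D DP] := choice (fun i => phi_norm_slope _ _ (dpsi i)).
pose h s := s^-1 *: (fs s - f0).
(* [e i s] comes from the exact slope of [phi]. It tends to [2 p i], which compensates the factor
   1/2 in the limit of [D i]. *)
pose e i s := p i + (y i - fs s).
pose gam s := \sum_i phi rho `|y i - fs s|.
(* Dividing the condition at [s] by [s (1 - s) / N] turns the weight [s] of [y'] into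
   [N / (1 - s)]. *)
pose c s := N%:R / (1 - s) * phi rho `|y' - fs s|.
have key s (t : V) : 0 < s < 1 ->
    gam s * dot t (h s) + \sum_j D j (fs s) * dot t (p j) * dot (e j s) (h s)
    = c s * dot t (y' - fs s).
  move=> s01; have /andP[s0 s1] := s01.
  have Nn0 : N%:R != 0 :> R by rewrite pnatr_eq0 -lt0n.
  have sn0 : s != 0 by rewrite gt_eqF.
  have s1n0 : 1 - s != 0 by rewrite subr_eq0 gt_eqF.
  have hE : fs s - f0 = s *: h s by rewrite /h scalerA mulfV// scale1r.
  have /(congr1 (dot t)) := fs_crit _ s01.
  rewrite dot0r dotDr dotZr dot_sumr.
  have -> : \sum_i dot t (((1 - s) / N%:R * phi rho `|y i - fs s|) *: (y i - fs s))
      = (1 - s) / N%:R * \sum_i phi rho `|y i - fs s| * dot t (y i - fs s).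
    by rewrite mulr_sumr; apply: eq_bigr => i _; rewrite dotZr mulrA.
  (* The terms of order zero in [s] add up to zero by [f0_crit], so that a factor [s] comes out. *)
  have -> : \sum_i phi rho `|y i - fs s| * dot t (y i - fs s) =
      - s * (gam s * dot t (h s) + \sum_j D j (fs s) * dot t (p j) * dot (e j s) (h s)).
    have -> : \sum_i phi rho `|y i - fs s| * dot t (y i - fs s) =
        \sum_i (dot t (phi rho `|p i| *: p i) - s * (D i (fs s) * dot t (p i) * dot (e i s) (h s))
          - s * (phi rho `|y i - fs s| * dot t (h s))).
      apply: eq_bigr => i _.
      have -> : dot t (y i - fs s) = dot t (p i) - s * dot t (h s).
        by rewrite -dotZr -hE -dotNr -dotDr opprB addrA subrK.
      have /(congr1 (dot t)) := (DP i).1 (fs s).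
      rewrite hE (dotDr _ _ (phi _ _ *: _)) dotNr !(dotZr dot _ t) dotZr.
      rewrite -/(p i) -/(e i s) => phiE; rewrite mulrBr phiE; ring.
    rewrite !sumrB -dot_sumr f0_crit dot0r -!mulr_sumr -mulr_suml -/(gam s).
    ring.
  rewrite /c; move: (gam s * _ + _) (phi _ _) (dot _ (y' - _)) => L a b E.
  (* The equation [E] is solved for [L] by subtracting a multiple of its left-hand side, which is
     zero. *)
  have -> : L = N%:R / (1 - s) * a * b -
      N%:R / (1 - s) / s * ((1 - s) / N%:R * (- s * L) + s * a * b).
    by field; apply/and3P.
  by rewrite E mulr0 subr0.
have fsc (w : V) : w - fs s @[s --> 0^'+] --> w - f0.
  by apply: cvgB => //; exact: cvg_cst.
have phic (w : V) : phi rho `|w - fs s| @[s --> 0^'+] --> phi rho `|w - f0|.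
  by apply: phi_cvg => //; exact: cvg_norm.
have gamc : gam s @[s --> 0^'+] --> gamma.
  by apply: cvg_sumr => i _; exact: phic.
have ec i : e i s @[s --> 0^'+] --> p i + p i.
  by apply: cvgD; [exact: cvg_cst|exact: fsc].
have Dc i : D i (fs s) @[s --> 0^'+] --> 2^-1 * Q i.
  exact: (cvg_comp _ _ fs_cvg (DP i).2).
have cc : c s @[s --> 0^'+] --> N%:R * phi rho `|y' - f0|.
  have inv1 : (1 - s)^-1 @[s --> (0 : R)^'+] --> (1 - 0 : R)^-1.
    apply: cvgV; first by rewrite subr0 oner_neq0.
    by apply: cvgB; [exact: cvg_cst|exact: cvg_at_right_filter cvg_id].
  rewrite subr0 invr1 in inv1; rewrite -[N%:R in X in _ --> X]mulr1.
  by apply: cvgM => //; apply: cvgM => //; exact: cvg_cst.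
have near01 : \forall s \near (0 : R)^'+, 0 < s < 1.
  near=> s.
  have s0 : 0 < s by near: s; exact: nbhs_right_gt.
  have s1 : s < 1 by near: s; exact: nbhs_right_lt.
  by rewrite s0 s1.
(* Taking [t = e i s] in [key] closes the equations in the [N] unknowns [dot (e i s) (h s)]. *)
pose A s : 'M[R]_N := (gam s)%:M + \matrix_(i, j) (D j (fs s) * dot (e i s) (p j)).
pose B : 'M[R]_N := gamma%:M + \matrix_(i, j) (Q j * dot (p i) (p j)).
pose b s : 'cV[R]_N := \col_i (c s * dot (e i s) (y' - fs s)).
pose bl : 'cV[R]_N := \col_i (N%:R * phi rho `|y' - f0| * dot (p i + p i) (y' - f0)).
pose u s : 'cV[R]_N := \col_i dot (e i s) (h s).
pose ul : 'cV[R]_N := \col_i dot (p i + p i) h0.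
have h0_dot t : gamma * dot t h0 + \sum_j Q j * dot t (p j) * dot (p j) h0 =
    N%:R * phi rho `|y' - f0| * dot t (y' - f0).
  rewrite -!dotZr -h0E dotDr dotZr dot_sumr; congr (_ + _).
  by apply: eq_bigr => j _; rewrite dotZr mulrAC.
have uc i : u s i 0 @[s --> 0^'+] --> ul i 0.
  apply: (@cvg_linear_system _ _ _ _ _ A B b u bl ul).
  (* [det0P] gives a row vector in the left kernel; transposing turns it into the column vector that
     [nondegenerate] expects. *)
  - rewrite -det_tr; apply/det0P => -[v v0 /(congr1 trmx)].
    rewrite trmx_mul trmxK trmx0 => Bv.
    have /(congr1 trmx)/eqP : v^T = 0.
      apply: nondegenerate => k; move/matrixP/(_ k 0): Bv.
      rewrite mulmxDl mul_scalar_mx !mxE => Bk; rewrite -[RHS]Bk; congr (_ + _).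
      by apply: eq_bigr => j _; rewrite !mxE.
    by rewrite trmxK trmx0; exact/negP.
  - apply/matrixP => k j; rewrite ord1 mulmxDl mul_scalar_mx !mxE -h0_dot.
    congr (_ + _); apply: eq_bigr => l _; rewrite !mxE !dotDl; ring.
  - move=> k j; rewrite !mxE.
    rewrite (_ : (fun s => A s k j) = (fun s => gam s * (k == j)%:R +
      D j (fs s) * dot (e k s) (p j))); last first.
      by apply/funext => s; rewrite !mxE mulr_natr.
    have -> : gamma *+ (k == j) + Q j * dot (p k) (p j) =
      gamma * (k == j)%:R + 2^-1 * Q j * dot (p k + p k) (p j).
      by rewrite mulr_natr (dotDl _ (p k) (p k)); lra.
    apply: cvgD; first by apply: cvgM => //; exact: cvg_cst.
    by apply: cvgM => //; apply: (cvg_dot _ norm_dot) => //; exact: cvg_cst.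
  - move=> k; rewrite (_ : (fun s => b s k 0) = (fun s => c s * dot (e k s) (y' - fs s))).
      by rewrite mxE; apply: cvgM => //; exact: (cvg_dot _ norm_dot).
    by apply/funext => s; rewrite mxE.
  - apply: filterS near01 => s s01; apply/matrixP => k j.
    rewrite ord1 mulmxDl mul_scalar_mx !mxE -key//; congr (_ + _).
    by apply: eq_bigr => l _; rewrite !mxE.
(* Now [key] at [t = z] expresses the wanted pairing through quantities whose limits are known. *)
have dot_hE s : 0 < s < 1 -> gam s != 0 -> dot z (h s) =
    (gam s)^-1 * (c s * dot z (y' - fs s) - \sum_j D j (fs s) * dot z (p j) * u s j 0).
  move=> s01 gs0; under eq_bigr do rewrite mxE.
  by rewrite -key// addrK mulKf.
have -> : dot z h0 = gamma^-1 * (N%:R * phi rho `|y' - f0| * dot z (y' - f0) -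
    \sum_j 2^-1 * Q j * dot z (p j) * ul j 0).
  rewrite -h0_dot (_ : \sum_j 2^-1 * _ * _ * _ = \sum_j Q j * dot z (p j) * dot (p j) h0).
    by rewrite addrK mulKf.
  by apply: eq_bigr => j _; rewrite mxE (dotDl _ (p j) (p j)); lra.
have lim_h : (gam s)^-1 * (c s * dot z (y' - fs s) -
    \sum_j D j (fs s) * dot z (p j) * u s j 0) @[s --> 0^'+] -->
    gamma^-1 * (N%:R * phi rho `|y' - f0| * dot z (y' - f0) -
    \sum_j 2^-1 * Q j * dot z (p j) * ul j 0).
  apply: cvgM; first exact: cvgV.
  apply: cvgB.
    by apply: cvgM => //; apply: (cvg_dot _ norm_dot) => //; exact: cvg_cst.
  apply: cvg_sumr => j _; apply: cvgM => //; apply: cvgM => //; exact: cvg_cst.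
apply: cvg_trans lim_h; apply: near_eq_cvg; near=> s.
rewrite -/(h s) dot_hE//; near: s => //.
exact: (cvgr_neq0 _ gamc gamma0).
Unshelve. all: by end_near. Qed.

End linearization.

(** * Objectives and critical points for the empirical and contaminated distributions *)

Section objective.
Context dT (T : measurableType dT) (R : realType).
Hypothesis m1 : forall x : T, measurable [set x].
Variables (k : T -> T -> R) (H : rkhs k) (rho : R -> R).
Hypothesis hA : loss_assumptions rho.
Variables (n : nat) (X : 'I_n.+1 -> T) (x' : T).

Lemma rkde_objective_empirical (g : H) :
  rkde_objective rho (empirical R X) g =
  (\sum_i n.+1%:R^-1 * rho `|rkhs_feature H (X i) - g|)%:E.
Proof.
apply: (integral_diracs _ T R m1 _ _ (fun=> n.+1%:R^-1) X).
- by move=> _; rewrite invr_ge0.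
- by move=> A _; rewrite -ge0_sume_distrr.
- by move=> t; apply: (rho_ge0 hA).
Qed.

Definition contamination_weight (s : R) (j : 'I_n.+2) : R :=
  if unlift ord_max j is Some _ then (1 - s) / n.+1%:R else s.

(** The codomain is general so as to serve both extended-real measures and vectors of [H]. *)
Lemma big_extend_points (U : nmodType) (s : R) (F : R -> T -> U) :
  \sum_j F (contamination_weight s j) (extend_points X x' j) =
  \sum_i F ((1 - s) / n.+1%:R) (X i) + F s x'.
Proof.
rewrite (bigD1_ord ord_max)//= addrC; congr (_ + _).
  by apply: eq_bigr => i _; rewrite /contamination_weight /extend_points liftK.
by rewrite /contamination_weight /extend_points unlift_none.
Qed.

Lemma rkde_objective_contaminated (s : R) (g : H) : 0 <= s <= 1 ->
  rkde_objective rho (contaminated (empirical R X) x' s) g =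
  (\sum_j contamination_weight s j *
     rho `|rkhs_feature H (extend_points X x' j) - g|)%:E.
Proof.
move=> /andP[s0 s1].
apply: (integral_diracs _ T R m1 _ _ (contamination_weight s) (extend_points X x')).
- move=> j; rewrite /contamination_weight; case: unliftP => // _ _.
  by rewrite divr_ge0// subr_ge0.
- move=> A _.
  rewrite (big_extend_points _ _ (fun a t => a%:E * \d_t A)%E).
  rewrite /= /contaminated /clamp01 min_l// max_r//=; congr (_ + _)%E.
  rewrite /empirical muleA -EFinM ge0_sume_distrr//.
- by move=> t; apply: (rho_ge0 hA).
Qed.

Hypothesis hrho : loss_differentiable rho.

Lemma rkde_empirical_critical (f : H) :
  rkde_argmin rho (empirical R X) f ->
  \sum_i phi rho `|rkhs_feature H (X i) - f| *: (rkhs_feature H (X i) - f) = 0.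
Proof.
move=> fmin.
have : \sum_i (n.+1%:R^-1 * phi rho `|rkhs_feature H (X i) - f|) *:
    (rkhs_feature H (X i) - f) = 0.
  apply: (argmin_first_order hrho hA _ (@rkhs_norm_dot _ _ _ H)) => g.
  by have := fmin g; rewrite !rkde_objective_empirical lee_fin.
under eq_bigr do rewrite -scalerA.
rewrite -scaler_sumr => /eqP; rewrite scaler_eq0 invr_eq0 pnatr_eq0/=.
by move/eqP.
Qed.

Lemma rkde_contaminated_critical (s : R) (f : H) : 0 <= s <= 1 ->
  rkde_argmin rho (contaminated (empirical R X) x' s) f ->
  \sum_i ((1 - s) / n.+1%:R * phi rho `|rkhs_feature H (X i) - f|) *:
    (rkhs_feature H (X i) - f) +
  (s * phi rho `|rkhs_feature H x' - f|) *: (rkhs_feature H x' - f) = 0.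
Proof.
move=> s01 fmin.
rewrite -(big_extend_points _ _ (fun a t =>
  (a * phi rho `|rkhs_feature H t - f|) *: (rkhs_feature H t - f))).
apply: (argmin_first_order hrho hA _ (@rkhs_norm_dot _ _ _ H)) => g.
by have := fmin g; rewrite !rkde_objective_contaminated// lee_fin.
Qed.

End objective.

(** * From the linear system for [alpha] to the influence function *)

Theorem theorem5 (R : realType) (d n : nat)
  (k : d.-tuple R -> d.-tuple R -> R) (hk : smoothing_kernel k) (H : rkhs k)
  (rho : R -> R) (hrho : loss_differentiable rho) (hA : loss_assumptions rho)
  (X : 'I_n.+1 -> d.-tuple R) (x' : d.-tuple R)
  (f : probability (d.-tuple R) R -> H) (w : 'cV[R]_n.+1) :
  let Fn : probability (d.-tuple R) R := empirical R X in
  let Phi := rkhs_feature H in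
  let r := fun i => `|Phi (X i) - f Fn| in
  let r' := `|Phi x' - f Fn| in
  let gamma := \sum_(i < n.+1) phi rho (r i) in
  let Q : 'M[R]_n.+1 := diag_mx (\row_i (q rho (r i) / r i ^+ 3)) in
  let K := kernel_mx k X in
  let k' : 'cV[R]_n.+1 := \col_i k x' (X i) in
  let M : 'M[R]_n.+1 := 1%:M - const_mx 1 *m w^T in
  let alpha' := n.+1%:R * phi rho r' / gamma in
  forall
    (hmin : rkde_argmin rho Fn (f Fn))
    (hmins : forall s : R, 0 <= s < 1 ->
       rkde_argmin rho (contaminated Fn x' s) (f (contaminated Fn x' s)))
    (hcont : f (contaminated Fn x' s) @[s --> 0^'+] --> f Fn)
    (hpsi' : forall i, 0 < r i -> derivable (psi rho) (r i) 1)
    (hK' : pos_def_mx (kernel_mx k (extend_points X x')))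
    (hw : rkde_weights rho X (f Fn) w)
    (alpha : 'cV[R]_n.+1)
    (halpha : unique
       (fun a : 'cV[R]_n.+1 =>
          (gamma%:M + M^T *m Q *m M *m K) *m a =
          - (n.+1%:R * phi rho r') *: w - alpha' *: (M^T *m Q *m M *m k'))
       alpha)
    (x : d.-tuple R),
  influence_exists (rkde f) Fn x x' /\
  influence_function (rkde f) Fn x x' =
    \sum_(i < n.+1) alpha i 0 * k x (X i) + alpha' * k x x'.
Proof.
move=> Fn Phi r r' gamma Q K k' M alpha' hmin hmins hcont hpsi' _ hw alpha halpha x.
have m1 : forall t : d.-tuple R, measurable [set t] by exact: measurable_set1_tuple.
have norm_dot := @rkhs_norm_dot _ _ _ H.
set dot := rkhs_dot H in norm_dot.
have dotPhi s t : dot (Phi s) (Phi t) = k s t.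
  by rewrite -rkhs_reproducing rkhs_featureE.
pose p i := Phi (X i) - f Fn.
pose Qd i := q rho (r i) / r i ^+ 3.
(* [M] is the centering at [f Fn]: its row [i] lists the coefficients of [p i]. *)
have pE i : p i = \sum_j M i j *: Phi (X j).
  rewrite /p {1}(rkde_weights_sum hw).
  transitivity (\sum_j ((i == j)%:R *: Phi (X j) - w j 0 *: Phi (X j))).
    rewrite sumrB; congr (_ - _); rewrite (bigD1 i)//= eqxx scale1r big1 ?addr0//.
    by move=> j ji; rewrite eq_sym (negPf ji) scale0r.
  apply: eq_bigr => j _; rewrite -scalerBl; congr (_ *: _).
  by rewrite !mxE big_ord1 !mxE mul1r.
(* Summing [w i = c * phi (r i)] gives [c * gamma = 1]. *)
have gamma0 : gamma != 0.
  have [c wc] := rkde_weights_prop hw; have := rkde_weights1 hw.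
  under eq_bigr do rewrite wc.
  rewrite -mulr_sumr -/gamma => c1; apply: contra_eq_neq c1 => ->.
  by rewrite mulr0 eq_sym oner_neq0.
pose h0 := \sum_j alpha j 0 *: Phi (X j) + alpha' *: Phi x'.
have dot_p (a : 'cV[R]_n.+1) i : dot (p i) (\sum_j a j 0 *: Phi (X j)) = (M *m (K *m a)) i 0.
  rewrite pE dot_suml mxE; apply: eq_bigr => j _; rewrite dotZl; congr (_ * _).
  rewrite dot_sumr mxE; apply: eq_bigr => l _.
  by rewrite dotZr dotPhi mxE mulrC.
have combQ (v : 'cV[R]_n.+1) :
    \sum_j (Qd j * v j 0) *: p j = \sum_j (M^T *m (Q *m v)) j 0 *: Phi (X j).
  under eq_bigr do rewrite pE scaler_sumr.
  rewrite exchange_big/=; apply: eq_bigr => j _; rewrite mxE scaler_suml.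
  apply: eq_bigr => i _; rewrite scalerA [M^T _ _]mxE mul_diag_mx !mxE.
  by rewrite mulrC.
have [alphaE alpha_uniq] := halpha.
have kernel0 (a : 'cV[R]_n.+1) :
    (gamma%:M + M^T *m Q *m M *m K) *m a = 0 -> a = 0.
  move=> a0; have : alpha = alpha + a.
    by apply: alpha_uniq; rewrite mulmxDr a0 addr0.
  by move/eqP; rewrite -{1}[alpha]addr0 (inj_eq (addrI _)) => /eqP.
have nondeg (u : 'cV[R]_n.+1) :
    (forall i, gamma * u i 0 + \sum_j Qd j * dot (p i) (p j) * u j 0 = 0) -> u = 0.
  (* The product is commuted: [a] lies in the kernel of the matrix of the [alpha] system, so
     [a = 0], and what remains of the equation for [u] is [gamma *: u = 0]. *)
  move=> uE; pose a := M^T *m (Q *m u).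
  have uM : gamma *: u + M *m (K *m a) = 0.
    apply/matrixP => i j; rewrite ord1 mxE [in RHS]mxE -[RHS](uE i) mxE.
    rewrite -dot_p -combQ dot_sumr; congr (_ + _).
    by apply: eq_bigr => l _; rewrite dotZr mulrAC.
  have /kernel0 a0 : (gamma%:M + M^T *m Q *m M *m K) *m a = 0.
    rewrite mulmxDl mul_scalar_mx -!mulmxA {1}/a !scalemxAr -!mulmxDr.
    by rewrite uM !mulmx0.
  move: uM; rewrite a0 !mulmx0 addr0 => /eqP.
  by rewrite scaler_eq0 (negPf gamma0) => /eqP.
pose v : 'cV[R]_n.+1 := \col_i dot (p i) h0.
have vE : v = M *m (K *m alpha) + alpha' *: (M *m k').
  apply/matrixP => i j; rewrite ord1 !mxE dotDr dot_p dotZr mxE; congr (_ + _ * _).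
  rewrite pE dot_suml; apply: eq_bigr => l _; rewrite dotZl [k' _ _]mxE.
  by rewrite (dotC _ (Phi (X l))) dotPhi.
(* Coefficients are matched: on [Phi x'] by the choice of [alpha'], and on [Phi (X j)] by row [j] of
   the system for [alpha], after expanding [f Fn] with the weights. *)
have h0E : gamma *: h0 + \sum_j (Qd j * dot (p j) h0) *: p j =
    (n.+1%:R * phi rho r') *: (Phi x' - f Fn).
  have -> : \sum_j (Qd j * dot (p j) h0) *: p j = \sum_j (Qd j * v j 0) *: p j.
    by apply: eq_bigr => j _; rewrite mxE.
  rewrite combQ /h0 scalerDr scalerA.
  rewrite (_ : gamma * alpha' = n.+1%:R * phi rho r'); last first.
    by rewrite /alpha' mulrCA divff// mulr1.
  rewrite addrAC scaler_sumr -big_split/=.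
  rewrite scalerBr addrC; congr (_ + _).
  rewrite {1}(rkde_weights_sum hw) scaler_sumr -sumrN; apply: eq_bigr => j _.
  rewrite scalerA -scalerDl scalerA -scaleNr; congr (_ *: _).
  have /matrixP/(_ j 0) : gamma *: alpha + M^T *m (Q *m v) = - (n.+1%:R * phi rho r') *: w.
    move: alphaE; rewrite mulmxDl mul_scalar_mx -!mulmxA => /eqP.
    rewrite -subr_eq opprK => /eqP <-.
    by rewrite vE -addrA !scalemxAr -!mulmxDr.
  by rewrite !mxE mulNr.
have lim : influence_quotient (rkde f) Fn x x' s @[s --> 0^'+] --> dot (Phi x) h0.
  have -> : influence_quotient (rkde f) Fn x x' = fun s =>
      dot (Phi x) (s^-1 *: (f (contaminated Fn x' s) - f Fn)).
    apply/funext => s; rewrite /influence_quotient /rkde !rkhs_reproducing.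
    by rewrite dotZr dotDr dotNr mulrC.
  apply: (solution_path_derivative hA dot norm_dot _
    (fun i => Phi (X i)) (Phi x') (f Fn)
    (fun s => f (contaminated Fn x' s))) => //.
  - exact: rkde_empirical_critical.
  - move=> s /andP[s0 s1]; apply: rkde_contaminated_critical => //.
      by rewrite !ltW.
    by apply: hmins; rewrite ltW.
have dot_h0 : dot (Phi x) h0 = \sum_(i < n.+1) alpha i 0 * k x (X i) + alpha' * k x x'.
  rewrite dotDr dotZr dotPhi dot_sumr; congr (_ + _).
  by apply: eq_bigr => i _; rewrite dotZr dotPhi.
split; first by apply/cvg_ex; exists (dot (Phi x) h0).
by rewrite -dot_h0; apply: cvg_lim.
Qed.
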